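(* Let $\mu_x,\mu_y,L_{xy}>0$, and let $\mathcal{A}$ be any algorithm from the general proximal algorithm class. Let $F(x,y)=\frac{\mu_x}{2}\|x\|^2 + \frac{L_{xy}}{2}x^\top Ay - \frac{\mu_y}{2}\|y\|^2 - b^\top y$ on $\mathbb{R}^n\times\mathbb{R}^n$ with $A$ and $b=-\frac{L_{xy}^2}{4\mu_x}e_1$ as in the context, with saddle point $(x^*,y^* )$, and for orthogonal matrices $U,V\in\mathbb{R}^{n\times n}$ put $F_{U,V}(x,y)=F(Ux,Vy)$. Assume the dimension $n$ is sufficiently large. Then for any positive integer $k$ there exist orthogonal matrices $U,V$ such that $F_{U,V}\in\mathcal{B}(L_{xy},\mu_x,\mu_y)$ and, when $\mathcal{A}$ is applied to $F_{U,V}$ with initial solution $(x^0,y^0)=(0,0)$, the iterates and the output satisfy $$\{(x^0,y^0),\dots,(x^k,y^k)\}\subseteq U^\top\mathcal{H}_x^{4k-1}\times V^\top\mathcal{H}_y^{4k-1}\quad\text{and}\quad (\tilde x^k,\tilde y^k)\in U^\top\mathcal{H}_x^{4k+1}\times V^\top\mathcal{H}_y^{4k+1}.$$ Consequently, $$\|\tilde y^k-V^\top y^*\|^2\geq \frac{q^{4k+2}}{16}\|y^*-y^0\|^2,\qquad q = 1+\frac{2\mu_x\mu_y}{L_{xy}^2} - 2\sqrt{\Big(\frac{\mu_x\mu_y}{L_{xy}^2}\Big)^2 + \frac{\mu_x\mu_y}{L_{xy}^2}}.$$ As a result, it takes $\Omega\Big(\sqrt{\frac{L_{xy}^2}{\mu_x\mu_y}}\cdot\log\big(\frac1\epsilon\big)\Big)$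 iterations to output a solution with $O(\epsilon)$ duality gap.
   Context: Class $\mathcal{B}(L_{xy},\mu_x,\mu_y)$: problems $\min_x\max_y f(x)+x^\top Cy-g(y)$ with $f,g$ lower semicontinuous, $f$ $\mu_x$-strongly convex, $g$ $\mu_y$-strongly convex, $\|C\|_2\le L_{xy}$. $\mathbf{prox}_{\gamma f}(v)=\arg\min_x f(x)+\frac{1}{2\gamma}\|x-v\|^2$, and similarly $\mathbf{prox}_{\sigma g}(u)=\arg\min_y g(y)+\frac{1}{2\sigma}\|y-u\|^2$. General proximal algorithm class: let $\theta=(L_{xy},\mu_x,\mu_y)$. An algorithm $\mathcal{A}$ consists of a sequence of deterministic mappings $(\mathcal{A}_x^k,\mathcal{A}_y^k,\mathcal{A}_u^k,\mathcal{A}_v^k)_{k\ge1}$ (not necessarily linear), with step sizes $\gamma_k,\sigma_k>0$. Given any initial $(x^0,y^0)$, iterates $(x^k,y^k)$ and outputs $(\tilde x^k,\tilde y^k)$ are generated by $$(x^k,\tilde x^k)=\mathcal{A}_x^k\big(\theta;x^0,Cy^0,\dots,x^{k-1},Cy^{k-1};\mathbf{prox}_{\gamma_kf}(u^k)\big),$$ $$(y^k,\tilde y^k)=\mathcal{A}_y^k\big(\theta;y^0,C^\top x^0,\dots,y^{k-1},C^\top x^{k-1};\mathbf{prox}_{\sigma_kg}(v^k)\big),$$ where $u^k=\mathcal{A}_u^k(\theta;x^0,Cy^0,\dots,x^{k-1},Cy^{k-1})$ and $v^k=\mathcal{A}_v^k(\theta;y^0,C^\top x^0,\dots,y^{k-1},C^\top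 x^{k-1})$. Explicitly, $F_{U,V}(x,y)=\frac{\mu_x}{2}\|x\|^2+\frac{L_{xy}}{2}x^\top U^\top AVy-\frac{\mu_y}{2}\|y\|^2-b^\top Vy$, so $f(x)=\frac{\mu_x}{2}\|x\|^2$, $g(y)=\frac{\mu_y}{2}\|y\|^2+b^\top Vy$, $C=\frac{L_{xy}}{2}U^\top AV$; its saddle point is $(U^\top x^*,V^\top y^* )$. $A\in\mathbb{R}^{n\times n}$: $A_{i,n+1-i}=1$ for $1\le i\le n$, $A_{i,n+2-i}=-1$ for $2\le i\le n$, other entries $0$. $e_1$ is the first standard basis vector. Subspaces: $\mathcal{H}_x^1=\{0\}$, $\mathcal{H}_x^j=\mathrm{Span}\{A^{2i}(Ab):0\le i\le\lfloor j/2\rfloor-1\}$ for $j\ge2$, and $\mathcal{H}_y^j=\mathrm{Span}\{A^{2i}b:0\le i\le\lceil j/2\rceil-1\}$ for $j\ge1$. The duality gap of $(\tilde x,\tilde y)$ for a function $G$ is $\max_yG(\tilde x,y)-\min_xG(x,\tilde y)$. ''Sufficiently large'' $n$ may depend on $k$ and the parameters. In the $\Omega$ statement absolute constants are hidden, $\epsilon\to0$, and problem-dependent factors inside the logarithm are suppressed. *)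

(* Defs.v *)
From HB Require Import structures.
From mathcomp Require Import all_boot all_order all_algebra.
From mathcomp Require Import all_classical all_reals all_analysis.
Set Implicit Arguments.
Unset Strict Implicit.
Unset Printing Implicit Defensive.
Import Order.TTheory GRing.Theory Num.Theory.
Import numFieldNormedType.Exports.
Local Open Scope classical_set_scope.
Local Open Scope ring_scope.

Section Euclidean.
Variable R : realType.

(* The library norm on matrices is the sup norm, hence these. *)
Definition dotp n (x y : 'cV[R]_n) : R := (x^T *m y) 0 0.
Definition sqnorm n (x : 'cV[R]_n) : R := dotp x x.
Definition l2norm n (x : 'cV[R]_n) : R := Num.sqrt (sqnorm x).

Definition spectral_norm m n (C : 'M[R]_(m, n)) : R :=
  sup [set l2norm (C *m x) | x in [set x : 'cV[R]_n | l2norm x <= 1]].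

Definition orthogonal_mx n (U : 'M[R]_n) : Prop := U^T *m U = 1%:M.

(* U^T H *)
Definition orth_image n (U : 'M[R]_n) (H : {vspace 'cV[R]_n}) :
  {vspace 'cV[R]_n} := (linfun (mulmx U^T : 'cV[R]_n -> 'cV[R]_n) @: H)%VS.

End Euclidean.

Section BilinearClass.
Variable R : realType.

(* f and g are extended-valued, so that lower semicontinuity is not implied by
   convexity; as usual they are required to be proper. *)
Definition proper n (f : 'cV[R]_n -> \bar R) : Prop :=
  (forall x, f x != -oo%E) /\ (exists x, f x != +oo%E).

Definition strongly_convex n (mu : R) (f : 'cV[R]_n -> \bar R) : Prop :=
  forall (x y : 'cV[R]_n) (t : R), 0 <= t <= 1 ->
  (f (t *: x + (1 - t) *: y)%R
     + (mu / 2 * (t * (1 - t)) * sqnorm (x - y))%R%:E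
   <= t%:E * f x + (1 - t)%R%:E * f y)%E.

(* min_x max_y f(x) + x^T C y - g(y) *)
Record bilinear_problem (n m : nat) := BilinearProblem {
  prob_f : 'cV[R]_n -> \bar R;
  prob_g : 'cV[R]_m -> \bar R;
  prob_C : 'M[R]_(n, m) }.

Definition objective n m (P : bilinear_problem n m)
    (x : 'cV[R]_n) (y : 'cV[R]_m) : \bar R :=
  (prob_f P x + (dotp x (prob_C P *m y))%:E - prob_g P y)%E.

Record params := Params { Lxy : R; mux : R; muy : R }.

Definition class_B (th : params) n m (P : bilinear_problem n m) : Prop :=
  [/\ proper (prob_f P) /\ proper (prob_g P),
      lower_semicontinuous (prob_f P) /\ lower_semicontinuous (prob_g P),
      strongly_convex (mux th) (prob_f P),
      strongly_convex (muy th) (prob_g P)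
    & spectral_norm (prob_C P) <= Lxy th].

Definition saddle_point n m (G : 'cV[R]_n -> 'cV[R]_m -> R)
    (z : 'cV[R]_n * 'cV[R]_m) : Prop :=
  forall x y, G z.1 y <= G z.1 z.2 <= G x z.2.

(* max_y G(x~, y) - min_x G(x, y~) *)
Definition duality_gap n m (G : 'cV[R]_n -> 'cV[R]_m -> R)
    (z : 'cV[R]_n * 'cV[R]_m) : \bar R :=
  (ereal_sup [set (G z.1 y)%:E | y in [set: 'cV[R]_m]]
   - ereal_inf [set (G x z.2)%:E | x in [set: 'cV[R]_n]])%E.

End BilinearClass.

Section ProximalAlgorithms.
Variable R : realType.

Definition is_prox n (gamma : R) (f : 'cV[R]_n -> \bar R)
    (v p : 'cV[R]_n) : Prop :=
  forall x, (f p + ((2 * gamma)^-1 * sqnorm (p - v))%R%:E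
             <= f x + ((2 * gamma)^-1 * sqnorm (x - v))%R%:E)%E.

(* The argmin exists and is unique for the functions occurring in class_B;
   the default value 0 is used only when there is no minimizer. *)
Definition prox n (gamma : R) (f : 'cV[R]_n -> \bar R) (v : 'cV[R]_n) :
  'cV[R]_n := xget 0 [set p | is_prox gamma f v p].

(* At iteration k >= 1, the x-side mappings receive the length-k history
   (x^0, C y^0), ..., (x^(k-1), C y^(k-1)), and the y-side mappings receive
   (y^0, C^T x^0), ..., (y^(k-1), C^T x^(k-1)).  alg_x and alg_y also receive
   the prox, and return the next iterate paired with the output. *)
Record prox_algorithm (n m : nat) := ProxAlgorithm {
  alg_gamma : params R -> nat -> R;
  alg_sigma : params R -> nat -> R;
  alg_gamma_gt0 : forall th k, 0 < alg_gamma th k;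
  alg_sigma_gt0 : forall th k, 0 < alg_sigma th k;
  alg_u : nat -> params R -> seq ('cV[R]_n * 'cV[R]_n) -> 'cV[R]_n;
  alg_v : nat -> params R -> seq ('cV[R]_m * 'cV[R]_m) -> 'cV[R]_m;
  alg_x : nat -> params R -> seq ('cV[R]_n * 'cV[R]_n) -> 'cV[R]_n ->
          'cV[R]_n * 'cV[R]_n;
  alg_y : nat -> params R -> seq ('cV[R]_m * 'cV[R]_m) -> 'cV[R]_m ->
          'cV[R]_m * 'cV[R]_m }.

Section Run.
Variables (n m : nat) (th : params R) (Alg : prox_algorithm n m).
Variables (P : bilinear_problem R n m) (z0 : 'cV[R]_n * 'cV[R]_m).

Definition hist_x (h : seq ('cV[R]_n * 'cV[R]_m)) :=
  [seq (z.1, prob_C P *m z.2) | z <- h].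
Definition hist_y (h : seq ('cV[R]_n * 'cV[R]_m)) :=
  [seq (z.2, (prob_C P)^T *m z.1) | z <- h].

(* ((x^k, y^k), (x~^k, y~^k)) from h = [:: (x^0, y^0); ...; (x^(k-1), y^(k-1))] *)
Definition step (k : nat) (h : seq ('cV[R]_n * 'cV[R]_m)) :
    ('cV[R]_n * 'cV[R]_m) * ('cV[R]_n * 'cV[R]_m) :=
  let px := prox (alg_gamma Alg th k) (prob_f P) (alg_u Alg k th (hist_x h)) in
  let py := prox (alg_sigma Alg th k) (prob_g P) (alg_v Alg k th (hist_y h)) in
  let rx := alg_x Alg k th (hist_x h) px in
  let ry := alg_y Alg k th (hist_y h) py in
  ((rx.1, ry.1), (rx.2, ry.2)).

(* [:: (x^0, y^0); ...; (x^k, y^k)] *)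
Fixpoint history (k : nat) : seq ('cV[R]_n * 'cV[R]_m) :=
  if k is k'.+1 then rcons (history k') (step k (history k')).1 else [:: z0].

Definition iterate (k : nat) : 'cV[R]_n * 'cV[R]_m := last z0 (history k).

(* (x~^k, y~^k), meaningful for k >= 1 *)
Definition output (k : nat) : 'cV[R]_n * 'cV[R]_m :=
  (step k (history k.-1)).2.

End Run.
End ProximalAlgorithms.

Section HardInstance.
Variable R : realType.

(* With 0-based i, j: A_{i,n+1-i} = 1 reads i + j + 1 = n, and
   A_{i,n+2-i} = -1 (2 <= i <= n) reads i + j = n. *)
Definition hard_A n : 'M[R]_n :=
  \matrix_(i < n, j < n)
    if (i + j).+1 == n then 1 else if (i + j)%N == n then -1 else 0.

Definition e1 n : 'cV[R]_n := \col_(i < n) (nat_of_ord i == 0%N)%:R.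

Definition hard_b (th : params R) n : 'cV[R]_n :=
  (- (Lxy th ^+ 2 / (4 * mux th))) *: e1 n.

Definition hard_F (th : params R) n (x y : 'cV[R]_n) : R :=
  mux th / 2 * sqnorm x + Lxy th / 2 * dotp x (hard_A n *m y)
  - muy th / 2 * sqnorm y - dotp (hard_b th n) y.

Definition rotated_F (th : params R) n (U V : 'M[R]_n) (x y : 'cV[R]_n) : R :=
  hard_F th (U *m x) (V *m y).

Definition rotated_problem (th : params R) n (U V : 'M[R]_n) :
    bilinear_problem R n n :=
  BilinearProblem
    (fun x => (mux th / 2 * sqnorm x)%:E)
    (fun y => (muy th / 2 * sqnorm y + dotp (hard_b th n) (V *m y))%:E)
    ((Lxy th / 2) *: (U^T *m hard_A n *m V)).

(* [rotated_problem] writes F_{U,V} as f(x) + x^T C y - g(y). *)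
Definition rotated_F_in_class (th : params R) n (U V : 'M[R]_n) : Prop :=
  (forall x y, objective (rotated_problem th U V) x y
               = (rotated_F th U V x y)%:E)
  /\ class_B th (rotated_problem th U V).

(* The index ranges 0 <= i <= floor(j/2) - 1 and 0 <= i <= ceil(j/2) - 1 have
   lengths floor(j/2) and ceil(j/2); in particular hard_Hx th n 1 = 0. *)
Definition hard_Hx (th : params R) n (j : nat) : {vspace 'cV[R]_n} :=
  <<[seq hard_A n ^+ (2 * i) *m (hard_A n *m hard_b th n)
      | i <- iota 0 j./2]>>%VS.

Definition hard_Hy (th : params R) n (j : nat) : {vspace 'cV[R]_n} :=
  <<[seq hard_A n ^+ (2 * i) *m hard_b th n | i <- iota 0 (uphalf j)]>>%VS.

Definition rate_q (th : params R) : R :=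
  let kappa := mux th * muy th / Lxy th ^+ 2 in
  1 + 2 * kappa - 2 * Num.sqrt (kappa ^+ 2 + kappa).

End HardInstance.

(* Main.v *)
Require Import Defs.
From mathcomp Require Import all_boot all_order all_algebra.
From mathcomp Require Import all_classical all_reals all_analysis.
From mathcomp Require Import zify ring lra.
Import Order.TTheory GRing.Theory Num.Theory.
Import numFieldNormedType.Exports.
Local Open Scope ring_scope.

Set Implicit Arguments.
Unset Strict Implicit.
Unset Printing Implicit Defensive.

(** The matrix A maps the span of the first m coordinates to the span of the last
    m, and the span of the last m coordinates to the span of the first m+1, so each
    exchange with the oracle reveals only one new coordinate per side.  Against an
    arbitrary deterministic algorithm, the rotations are built adaptively:
    at iteration k+1, U and V are replaced by Q U and W V, where Q and W are
    products of two reflections that fix all coordinates revealed so far and send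
    the new iterate and the new output into the next two coordinates.  Since Q and
    W fix everything the oracle has shown (including V^T b, hence the prox of g),
    the earlier iterations do not change.
    The saddle point satisfies (A^2 + 4 kappa) y = e_1 with A^2 tridiagonal, so
    that y_i = c (q^i - q^(2n-i)); the coordinates missed by the output carry a
    fraction of order q^(4k+2) of the squared norm of y.  For the complexity bound,
    strong concavity bounds the gap below by muy/2 times the squared distance,
    and q >= exp (- 4 sqrt kappa). *)

(** * Euclidean geometry: inner products, orthogonal matrices and Householder reflections *)

Section EuclideanSpace.
Variable R : realType.
Implicit Types n : nat.

Lemma dotpE n (x y : 'cV[R]_n) : dotp x y = \sum_i x i 0 * y i 0.
Proof. by rewrite /dotp mxE; apply: eq_bigr => i _; rewrite mxE. Qed.

Lemma dotpC n (x y : 'cV[R]_n) : dotp x y = dotp y x.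
Proof. by rewrite !dotpE; apply: eq_bigr => i _; rewrite mulrC. Qed.

Lemma dotpDr n (x y z : 'cV[R]_n) : dotp x (y + z) = dotp x y + dotp x z.
Proof. by rewrite /dotp mulmxDr mxE. Qed.

Lemma dotpZr n (x y : 'cV[R]_n) a : dotp x (a *: y) = a * dotp x y.
Proof. by rewrite /dotp -scalemxAr mxE. Qed.

Lemma dotpDl n (x y z : 'cV[R]_n) : dotp (y + z) x = dotp y x + dotp z x.
Proof. by rewrite !(dotpC _ x) dotpDr. Qed.

Lemma dotpZl n (x y : 'cV[R]_n) a : dotp (a *: x) y = a * dotp x y.
Proof. by rewrite !(dotpC _ y) dotpZr. Qed.

Lemma dotpBr n (x y z : 'cV[R]_n) : dotp x (y - z) = dotp x y - dotp x z.
Proof. by rewrite /dotp mulmxBr !mxE. Qed.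

Lemma dotpBl n (x y z : 'cV[R]_n) : dotp (y - z) x = dotp y x - dotp z x.
Proof. by rewrite !(dotpC _ x) dotpBr. Qed.

Lemma dotp_mulmx m n (C : 'M[R]_(m, n)) x y :
  dotp x (C *m y) = dotp (C^T *m x) y.
Proof. by rewrite /dotp trmx_mul trmxK mulmxA. Qed.

Lemma sqnormE n (x : 'cV[R]_n) : sqnorm x = \sum_i x i 0 ^+ 2.
Proof. by rewrite /sqnorm dotpE; apply: eq_bigr => i _; rewrite expr2. Qed.

Lemma sqnorm_ge0 n (x : 'cV[R]_n) : 0 <= sqnorm x.
Proof. by rewrite sqnormE sumr_ge0 // => i _; rewrite sqr_ge0. Qed.

Lemma sqnorm0 n : sqnorm (0 : 'cV[R]_n) = 0.
Proof. by rewrite sqnormE big1 // => i _; rewrite mxE expr0n. Qed.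

Lemma sqnormZ n a (x : 'cV[R]_n) : sqnorm (a *: x) = a ^+ 2 * sqnorm x.
Proof. by rewrite /sqnorm dotpZl dotpZr mulrA -expr2. Qed.

Lemma sqnorm_eq0 n (x : 'cV[R]_n) : (sqnorm x == 0) = (x == 0).
Proof.
apply/idP/eqP => [|->]; last by rewrite sqnorm0.
rewrite sqnormE psumr_eq0 => [/allP h|i _]; last exact: sqr_ge0.
apply/colP => i; rewrite mxE; apply/eqP.
by have := h i (mem_index_enum i); rewrite sqrf_eq0.
Qed.

Lemma sqnorm_orthogonal n (U : 'M[R]_n) x :
  orthogonal_mx U -> sqnorm (U *m x) = sqnorm x.
Proof.
by move=> oU; rewrite /sqnorm dotp_mulmx mulmxA oU mul1mx.
Qed.

Lemma orthogonal_mxC n (U : 'M[R]_n) : orthogonal_mx U -> U *m U^T = 1%:M.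
Proof. exact: mulmx1C. Qed.

Lemma orthogonal_trmx n (U : 'M[R]_n) : orthogonal_mx U -> orthogonal_mx U^T.
Proof. by move=> oU; rewrite /orthogonal_mx trmxK orthogonal_mxC. Qed.

Lemma orthogonal_mul n (U V : 'M[R]_n) :
  orthogonal_mx U -> orthogonal_mx V -> orthogonal_mx (U *m V).
Proof.
move=> oU oV; rewrite /orthogonal_mx trmx_mul -mulmxA (mulmxA U^T).
by rewrite oU mul1mx.
Qed.

Lemma orthogonal_mx1 n : orthogonal_mx (1%:M : 'M[R]_n).
Proof. by rewrite /orthogonal_mx trmx1 mul1mx. Qed.

Lemma orthogonal_fixT n (Q : 'M[R]_n) (x : 'cV[R]_n) :
  orthogonal_mx Q -> Q *m x = x -> Q^T *m x = x.
Proof. by move=> oQ {1}<-; rewrite mulmxA oQ mul1mx. Qed.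

Definition supp_in n (S : {set 'I_n}) (x : 'cV[R]_n) : Prop :=
  forall i, i \notin S -> x i 0 = 0.

Lemma supp_in0 n (S : {set 'I_n}) : supp_in S 0.
Proof. by move=> i _; rewrite mxE. Qed.

Lemma supp_in_sub n (S T : {set 'I_n}) x :
  S \subset T -> supp_in S x -> supp_in T x.
Proof. by move=> ST Sx i iT; apply: Sx; apply: contra iT => /(fintype.subsetP ST). Qed.

Lemma supp_inZ n (S : {set 'I_n}) a x : supp_in S x -> supp_in S (a *: x).
Proof. by move=> Sx i iS; rewrite mxE Sx // mulr0. Qed.

(** Householder reflection along [v]; for [v = 0] the convention [x / 0 = 0] makes it the
    identity. *)
Definition reflection n (v : 'cV[R]_n) : 'M[R]_n :=
  1%:M - (2 / sqnorm v) *: (v *m v^T).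

Lemma reflection_mul n (v x : 'cV[R]_n) :
  reflection v *m x = x - (2 / sqnorm v * dotp v x) *: v.
Proof.
rewrite /reflection mulmxBl mul1mx -scalemxAl -mulmxA.
rewrite [v^T *m x]mx11_scalar -/(dotp v x) mul_mx_scalar scalerA.
by [].
Qed.

Lemma reflection_orthogonal n (v : 'cV[R]_n) : orthogonal_mx (reflection v).
Proof.
have tr : (reflection v)^T = reflection v.
  by rewrite /reflection linearB linearZ /= trmx1 trmx_mul trmxK.
have vv : (v *m v^T) *m (v *m v^T) = sqnorm v *: (v *m v^T).
  rewrite mulmxA -(mulmxA v) [v^T *m v]mx11_scalar -/(sqnorm v).
  by rewrite mul_mx_scalar scalemxAl.
rewrite /orthogonal_mx tr /reflection mulmxBl mul1mx mulmxBr mulmx1.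
rewrite -scalemxAl -scalemxAr vv !scalerA.
have [s0|s0] := eqVneq (sqnorm v) 0; first by rewrite s0 invr0 !(mulr0, scale0r) !subr0.
rewrite (_ : 2 / _ * (2 / _) * _ = 2 / sqnorm v + 2 / sqnorm v); last by field.
by rewrite scalerDl opprB addrK subrK.
Qed.

(** The reflection swaps [p'], which is [p] with its [S]-entries erased, and [a] times the [i0]-th
    basis vector, two vectors of equal norm. Its axis [v] vanishes on [S], so vectors supported in
    [S] are fixed and the [S]-part of [p] is left as it was. *)
Lemma exists_reflection n (S : {set 'I_n}) (i0 : 'I_n) (p : 'cV[R]_n) :
  i0 \notin S ->
  exists Q : 'M[R]_n, [/\ orthogonal_mx Q,
    forall x, supp_in S x -> Q *m x = x & supp_in (i0 |: S) (Q *m p)].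
Proof.
move=> i0S.
pose p' : 'cV[R]_n := \col_i (if i \in S then 0 else p i 0).
pose a := l2norm p'.
pose v := p' - a *: delta_mx i0 0.
have p'i i : p' i 0 = if i \in S then 0 else p i 0 by rewrite mxE.
have vi i : v i 0 = p' i 0 - a * (i == i0)%:R by rewrite !mxE eqxx andbT.
have aa : a ^+ 2 = sqnorm p' by rewrite sqr_sqrtr // sqnorm_ge0.
have dx (x : 'cV[R]_n) : dotp x (delta_mx i0 0) = x i0 0.
  rewrite dotpE (bigD1 i0) //= big1 ?mxE ?eqxx ?addr0 ?mulr1 // => i ni.
  by rewrite mxE (negbTE ni) mulr0.
have vp' : dotp v p' = a ^+ 2 - a * p' i0 0.
  by rewrite dotpBl dotpZl aa [dotp (delta_mx _ _) _]dotpC dx.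
have vp : dotp v p = dotp v p'.
  rewrite !dotpE; apply: eq_bigr => i _; rewrite p'i; case: ifP => // iS.
  rewrite vi p'i iS mulr0 (_ : i == i0 = false) ?mulr0 ?subr0 ?mul0r //.
  by apply: contraNF i0S => /eqP <-.
(* This expresses the equality of the two norms; it makes the reflection coefficient 1, so the image
   of [p] is [p - v]. *)
have vv : sqnorm v = 2 * dotp v p'.
  rewrite /sqnorm {2}/v dotpBr dotpZr dx vi eqxx mulr1 vp'.
  by ring.
exists (reflection v); split; first exact: reflection_orthogonal.
- move=> x Sx; rewrite reflection_mul dotpE big1 ?mulr0 ?scale0r ?subr0 //.
  move=> i _; have [iS|iS] := boolP (i \in S); last by rewrite Sx // mulr0.
  rewrite vi p'i iS (_ : i == i0 = false) ?mulr0 ?subr0 ?mul0r //.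
  by apply: contraNF i0S => /eqP <-.
- rewrite reflection_mul vp => i; rewrite !inE negb_or => /andP[ni iS].
  (* If [v = 0], then [p'] is already supported at [i0]. *)
  have [v0|v0] := eqVneq v 0.
    rewrite v0 scaler0 subr0; have := vi i; rewrite p'i (negbTE iS) v0 mxE.
    by rewrite (negbTE ni) mulr0 subr0.
  have v1 : dotp v p' != 0.
    by apply: contra v0 => /eqP h; rewrite -sqnorm_eq0 vv h mulr0.
  rewrite vv invfM mulrA divff ?pnatr_eq0 // mul1r mulVf // scale1r !mxE.
  by rewrite eqxx (negbTE iS) (negbTE ni) /= mulr0 subr0 subrr.
Qed.

(** Steers two vectors at once, later the iterate [p] and the output [w]; the second reflection
    fixes [i0 |: S] and so leaves the image of [p] in place. *)
Lemma exists_reflection2 n (S : {set 'I_n}) (i0 i1 : 'I_n) (p w : 'cV[R]_n) :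
  i0 \notin S -> i1 \notin i0 |: S ->
  exists Q : 'M[R]_n, [/\ orthogonal_mx Q,
    forall x, supp_in S x -> Q *m x = x,
    supp_in (i0 |: S) (Q *m p) & supp_in (i1 |: (i0 |: S)) (Q *m w)].
Proof.
move=> i0S i1S.
have [Q [oQ fQ sQ]] := exists_reflection p i0S.
have [W [oW fW sW]] := exists_reflection (Q *m w) i1S.
exists (W *m Q); split; first exact: orthogonal_mul.
- move=> x Sx; rewrite -mulmxA fQ // fW //.
  by apply: supp_in_sub Sx; apply: finset.subsetUr.
- by rewrite -mulmxA fW.
- by rewrite -mulmxA.
Qed.

End EuclideanSpace.

(** * Action of the hard matrix [A] on coordinates *)

Section HardMatrix.
Variable R : realType.

(** Vectors are given by functions on [nat], so that index shifts need no ordinals. The condition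
    [f n = 0] covers row 0, whose entry -1 would fall outside the matrix. *)
Lemma hard_A_mul n (f : nat -> R) (i : 'I_n) : f n = 0 ->
  (hard_A R n *m \col_j f j) i 0 = f (n - i.+1)%N - f (n - i)%N.
Proof.
move=> fn; have i_n := ltn_ord i.
have jP : (n - i.+1 < n)%N by lia.
rewrite mxE (bigD1 (Ordinal jP)) //= !mxE /= (_ : (i + _).+1 == n); last first.
  by apply/eqP; lia.
rewrite mul1r; congr (_ + _).
have [i0|i0] := posnP i.
  have -> : f (n - i)%N = 0 by rewrite i0 subn0.
  rewrite oppr0 big1 // => j /eqP nj; rewrite !mxE; have j_n := ltn_ord j.
  rewrite !ifF ?mul0r //; first by apply/eqP; lia.
  by apply/eqP => h; apply: nj; apply: val_inj => /=; lia.
have j'P : (n - i < n)%N by lia.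
rewrite (bigD1 (Ordinal j'P)) /=; last by apply/eqP => -[]; lia.
rewrite !mxE /= ifF; last by apply/eqP; lia.
rewrite ifT; last by apply/eqP; lia.
rewrite mulN1r big1 ?addr0 // => j /andP[/eqP nj /eqP nj']; rewrite !mxE.
rewrite !ifF ?mul0r //; apply/eqP => h.
  by apply: nj'; apply: val_inj => /=; lia.
by apply: nj; apply: val_inj => /=; lia.
Qed.

Lemma col_hard_A_mul n (f : nat -> R) : f n = 0 ->
  hard_A R n *m (\col_j f j) = \col_i (f (n - i.+1)%N - f (n - i)%N).
Proof. by move=> fn; apply/colP => i; rewrite hard_A_mul // mxE. Qed.

(* For [i = 0] the truncated [i.-1] makes the missing neighbour [f 0] itself. *)
Lemma hard_A2_mul n (f : nat -> R) : f n = 0 ->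
  hard_A R n *m (hard_A R n *m \col_j f j)
  = \col_i (f i - f i.+1 - (f i.-1 - f i)).
Proof.
move=> fn; rewrite col_hard_A_mul //.
pose g i := f (n - i.+1)%N - f (n - i)%N.
rewrite (col_hard_A_mul (f := g)); last first.
  by rewrite /g subnn (_ : (n - n.+1 = 0)%N) ?subrr //; lia.
apply/colP => i; rewrite !mxE /g; have i_n := ltn_ord i.
rewrite (_ : (n - (n - i.+1).+1 = i)%N); last lia.
rewrite (_ : (n - (n - i.+1) = i.+1)%N); last lia.
rewrite (_ : (n - (n - i) = i)%N); last lia.
by rewrite (_ : (n - (n - i).+1 = i.-1)%N) //; lia.
Qed.

Lemma trmx_hard_A n : (hard_A R n)^T = hard_A R n.
Proof. by apply/matrixP => i j; rewrite !mxE addnC. Qed.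

(** Padding by zero puts any vector in the form [\col_j f j] with [f n = 0], as [hard_A_mul]
    requires. *)
Definition extend n (x : 'cV[R]_n) (j : nat) : R :=
  if insub j is Some i then x i 0 else 0.

Lemma extendK n (x : 'cV[R]_n) : \col_i extend x i = x.
Proof. by apply/colP => i; rewrite mxE /extend valK. Qed.

Lemma extend_ge n (x : 'cV[R]_n) j : (n <= j)%N -> extend x j = 0.
Proof. by move=> nj; rewrite /extend insubF // ltnNge nj. Qed.

Lemma supp_extend n (S : {set 'I_n}) (P : pred nat) (x : 'cV[R]_n) j :
  (forall i : 'I_n, P i -> i \notin S) -> supp_in S x -> P j -> extend x j = 0.
Proof.
move=> PS Sx Pj; rewrite /extend; case: insubP => // i _ ij.
by rewrite Sx // PS // ij.
Qed.

Definition first_coords n m : {set 'I_n} := [set i : 'I_n | (i < m)%N].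
Definition last_coords n m : {set 'I_n} := [set i : 'I_n | (n <= i + m)%N].

Lemma first_coordsS n m k :
  (m <= k)%N -> first_coords n m \subset first_coords n k.
Proof. by move=> mk; apply/fintype.subsetP => i; rewrite !inE => h; lia. Qed.

Lemma last_coordsS n m k :
  (m <= k)%N -> last_coords n m \subset last_coords n k.
Proof. by move=> mk; apply/fintype.subsetP => i; rewrite !inE => h; lia. Qed.

(** Entry [i] of [A x] reads [x] only at [n - i - 1] and [n - i]; both are at least [m] when
    [i + m < n]. *)
Lemma hard_A_first n m (x : 'cV[R]_n) : supp_in (first_coords n m) x ->
  supp_in (last_coords n m) (hard_A R n *m x).
Proof.
move=> Sx i; rewrite inE -ltnNge => im; have i_n := ltn_ord i.
rewrite -[x]extendK hard_A_mul; last exact: extend_ge.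
have x0 j : (m <= j)%N -> extend x j = 0.
  by apply: supp_extend Sx => l; rewrite inE -leqNgt.
by rewrite !x0 ?subrr //; lia.
Qed.

(** The entries -1, which read [x] at [n - i], reach one coordinate further than the antidiagonal;
    this is where the support grows. *)
Lemma hard_A_last n m (x : 'cV[R]_n) : supp_in (last_coords n m) x ->
  supp_in (first_coords n m.+1) (hard_A R n *m x).
Proof.
move=> Sx i; rewrite inE -ltnNge ltnS => im; have i_n := ltn_ord i.
rewrite -[x]extendK hard_A_mul; last exact: extend_ge.
have x0 j : (j + m < n)%N -> extend x j = 0.
  by apply: (@supp_extend _ _ (fun j => (j + m < n)%N) x _ _ Sx) => l; rewrite inE -ltnNge.
by rewrite !x0 ?subrr //; lia.
Qed.

(** By [(a - b)^2 <= 2 a^2 + 2 b^2], applied to two shifted copies of [x]. Thus [A] has norm at most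
    2, which explains the factor [Lxy / 2] in the coupling. *)
Lemma sqnorm_hard_A n (x : 'cV[R]_n) :
  sqnorm (hard_A R n *m x) <= 4 * sqnorm x.
Proof.
set f := extend x; have fn : f n = 0 by rewrite /f extend_ge.
rewrite -[x]extendK -/f col_hard_A_mul // !sqnormE.
under eq_bigr => i _ do rewrite mxE.
under [X in _ <= _ * X]eq_bigr => i _ do rewrite mxE.
have s1 : \sum_(i < n) f (n - i.+1)%N ^+ 2 = \sum_(i < n) f i ^+ 2.
  rewrite (reindex_inj rev_ord_inj) /=; apply: eq_bigr => i _.
  by have i_n := ltn_ord i; congr (f _ ^+ 2); lia.
(* This shift drops [f 0] and brings in [f n = 0]. *)
have s2 : \sum_(i < n) f (n - i)%N ^+ 2 <= \sum_(i < n) f i ^+ 2.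
  rewrite (reindex_inj rev_ord_inj) /=.
  have -> : \sum_(i < n) f (n - (n - i.+1))%N ^+ 2 = \sum_(i < n) f i.+1 ^+ 2.
    by apply: eq_bigr => i _; rewrite subKn.
  have : \sum_(i < n.+1) f i ^+ 2 = f 0%N ^+ 2 + \sum_(i < n) f i.+1 ^+ 2.
    by rewrite big_ord_recl.
  by rewrite big_ord_recr /= fn expr0n addr0 => ->; rewrite lerDr sqr_ge0.
apply: (@le_trans _ _ (\sum_(i < n) (2 * f (n - i.+1)%N ^+ 2 + 2 * f (n - i)%N ^+ 2))).
  apply: ler_sum => i _; rewrite -subr_ge0.
  rewrite (_ : _ - _ = (f (n - i.+1)%N + f (n - i)%N) ^+ 2) ?sqr_ge0 //.
  by ring.
rewrite big_split /= -!mulr_sumr s1; lra.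
Qed.

End HardMatrix.

(** * Krylov subspaces of [A^2] and coordinate subspaces *)

Section KrylovSubspaces.
Variable R : realType.
Variable n : nat.
Local Notation A := (hard_A R n).

(** [hard_Hy th n j] is the case [v = b] with [m] the ceiling of [j / 2]; [hard_Hx th n j] is the
    case [v = A b] with the floor. *)
Definition krylov (v : 'cV[R]_n) (m : nat) : {vspace 'cV[R]_n} :=
  <<[seq A ^+ (2 * i) *m v | i <- iota 0 m]>>%VS.

Definition unit_vec (j : nat) : 'cV[R]_n := \col_i (nat_of_ord i == j)%:R.

Lemma krylovS v m k x :
  (m <= k)%N -> x \in krylov v m -> x \in krylov v k.
Proof.
move=> mk; apply/subvP/sub_span => {}x /mapP[i]; rewrite mem_iota => im ->.
by apply: map_f; rewrite mem_iota; lia.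
Qed.

Lemma krylov_sub m k (v w : 'cV[R]_n) (B : 'M[R]_n) x :
  (forall i, (i < m)%N -> B *m (A ^+ (2 * i) *m v) \in krylov w k) ->
  x \in krylov v m -> B *m x \in krylov w k.
Proof.
move=> Bv xv.
have : linfun (mulmx B : 'cV[R]_n -> 'cV[R]_n) x \in
    (linfun (mulmx B : 'cV[R]_n -> 'cV[R]_n) @: krylov v m)%VS.
  exact: memv_img.
rewrite lfunE /= limg_span; apply: subvP; apply/span_subvP => y.
rewrite -map_comp => /mapP[i]; rewrite mem_iota add0n => /= im ->.
by rewrite lfunE /=; apply: Bv.
Qed.

Lemma krylov_A2 v m x :
  x \in krylov v m -> A *m (A *m x) \in krylov v m.+1.
Proof.
rewrite mulmxA; apply: krylov_sub => i im.
apply: memv_span; apply/mapP; exists i.+1; first by rewrite mem_iota; lia.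
by rewrite mulmxA !mulmxE -expr2 -exprD; congr (_ ^+ _ *m _); lia.
Qed.

Lemma krylov_A v m x :
  x \in krylov v m -> A *m x \in krylov (A *m v) m.
Proof.
apply: krylov_sub => i im.
apply: memv_span; apply/mapP; exists i; first by rewrite mem_iota; lia.
by rewrite !mulmxA !mulmxE -exprS -exprSr.
Qed.

Lemma hard_A2_unit_vec j : (j.+1 < n)%N ->
  A *m (A *m unit_vec j.+1)
  = 2 *: unit_vec j.+1 - unit_vec j - unit_vec j.+2.
Proof.
move=> jn; rewrite (hard_A2_mul (f := fun i => (i == j.+1)%:R)); last first.
  by rewrite gtn_eqF.
apply/colP => i; rewrite !mxE eqSS.
case: (nat_of_ord i) => [|l] //=; rewrite ?eqSS; last by ring.
case: j {jn} => [|j] /=; ring.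
Qed.

Lemma hard_A2_unit_vec0 : (0 < n)%N ->
  A *m (A *m unit_vec 0) = unit_vec 0 - unit_vec 1.
Proof.
move=> n0; rewrite (hard_A2_mul (f := fun i => (i == 0)%N%:R)); last first.
  by rewrite gtn_eqF.
by apply/colP => i; rewrite !mxE; case: (nat_of_ord i) => [|[|l]] /=; ring.
Qed.

Lemma hard_A_unit_vec j : (j.+1 < n)%N ->
  A *m unit_vec j.+1 = unit_vec (n - j.+2) - unit_vec (n - j.+1).
Proof.
move=> jn; rewrite (col_hard_A_mul (f := fun i => (i == j.+1)%:R)); last first.
  by rewrite gtn_eqF.
apply/colP => i; rewrite !mxE; have i_n := ltn_ord i.
by congr (_%:R - _%:R); congr nat_of_bool; apply/eqP/eqP; lia.
Qed.

Lemma hard_A_unit_vec0 : (0 < n)%N -> A *m unit_vec 0 = unit_vec n.-1.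
Proof.
move=> n0; rewrite (col_hard_A_mul (f := fun i => (i == 0)%N%:R)); last first.
  by rewrite gtn_eqF.
apply/colP => i; rewrite !mxE; have i_n := ltn_ord i.
rewrite [X in _ - X](_ : _ = 0) ?subr0; last by rewrite gtn_eqF //; lia.
by congr (_%:R); congr nat_of_bool; apply/eqP/eqP; lia.
Qed.

Lemma supp_in_memv (S : {set 'I_n}) (H : {vspace 'cV[R]_n}) x :
  (forall i : 'I_n, i \in S -> unit_vec i \in H) -> supp_in S x -> x \in H.
Proof.
move=> SH Sx.
have -> : x = \sum_i x i 0 *: unit_vec i.
  apply/colP => i; rewrite summxE (bigD1 i) //= big1 ?addr0.
    by rewrite !mxE eqxx mulr1.
  by move=> j ij; rewrite !mxE val_eqE eq_sym (negbTE ij) mulr0.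
apply: memv_suml => i _; have [iS|/Sx ->] := boolP (i \in S).
  by apply: memvZ; apply: SH.
by rewrite scale0r mem0v.
Qed.

(** [A^2] is tridiagonal with off-diagonal entries -1, so each unit vector can be solved for from
    [A^2] applied to its predecessor and the two preceding unit vectors. *)
Lemma unit_vec_krylov j :
  (j < n)%N -> unit_vec j \in krylov (unit_vec 0) j.+1.
Proof.
(* The recursion looks two steps back, so the induction carries two consecutive indices. *)
suff: ((j < n)%N -> unit_vec j \in krylov (unit_vec 0) j.+1) /\
   ((j.+1 < n)%N -> unit_vec j.+1 \in krylov (unit_vec 0) j.+2) by case.
have e0 : unit_vec 0 \in krylov (unit_vec 0) 1.
  by apply: memv_span; rewrite /= inE muln0 expr0 mul1mx.
elim: j => [|j [IH1 IH2]].
  split=> // n1; rewrite (_ : unit_vec 1 = unit_vec 0 - A *m (A *m unit_vec 0)).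
    by rewrite memvB ?krylov_A2 // (krylovS _ e0).
  by rewrite hard_A2_unit_vec0 ?subKr //; lia.
split=> // jn.
have h1 := IH1 (ltnW (ltnW jn)); have h2 := IH2 (ltnW jn).
rewrite (_ : unit_vec _ = 2 *: unit_vec j.+1 - unit_vec j
   - A *m (A *m unit_vec j.+1)); last by rewrite hard_A2_unit_vec ?subKr //; lia.
rewrite !memvB ?memvZ ?krylov_A2 //.
  exact: krylovS h2.
by apply: krylovS h1; lia.
Qed.

(** [A] sends a unit vector to a difference of two neighbours near the end, so the last coordinates
    are recovered one at a time, starting from [A *m unit_vec 0]. *)
Lemma unit_vec_krylov_A j :
  (j < n)%N -> unit_vec (n - j.+1) \in krylov (A *m unit_vec 0) j.+1.
Proof.
elim: j => [|j IH] jn.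
  rewrite (_ : n - 1 = n.-1)%N; last lia.
  by rewrite -hard_A_unit_vec0 // krylov_A // unit_vec_krylov.
rewrite (_ : unit_vec _ = A *m unit_vec j.+1 + unit_vec (n - j.+1)).
  rewrite memvD ?krylov_A ?unit_vec_krylov //.
  exact: krylovS (IH (ltnW jn)).
by rewrite hard_A_unit_vec // subrK.
Qed.

(** Lets [b], a nonzero multiple of the first unit vector, replace it as generator. *)
Lemma krylovZ a v m : a != 0 -> (krylov v m <= krylov (a *: v) m)%VS.
Proof.
move=> a0; apply/span_subvP => y /mapP[i im ->].
rewrite -[_ *m v](scalerK a0) memvZ // memv_span //.
by apply/mapP; exists i => //; rewrite scalemxAr.
Qed.

Variable th : params R.
Hypothesis b_neq0 : - (Lxy th ^+ 2 / (4 * mux th)) != 0.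

(** Converts the coordinate supports forced by the adversary into membership in the Krylov spaces of
    the theorem. *)
Lemma mem_hard_Hy m j x : supp_in (first_coords n m) x ->
  (m <= uphalf j)%N -> x \in hard_Hy th n j.
Proof.
move=> Sx mj; rewrite /hard_Hy -/(krylov _ _); apply: (supp_in_memv _ Sx) => i.
rewrite inE => im; rewrite /hard_b; apply: (subvP (krylovZ _ _ b_neq0)).
by apply: krylovS (unit_vec_krylov (ltn_ord i)); lia.
Qed.

Lemma mem_hard_Hx m j x : supp_in (last_coords n m) x ->
  (m <= j./2)%N -> x \in hard_Hx th n j.
Proof.
move=> Sx mj; rewrite /hard_Hx -/(krylov _ _); apply: (supp_in_memv _ Sx) => i.
rewrite inE => im; rewrite /hard_b -scalemxAr.
apply: (subvP (krylovZ _ _ b_neq0)); have i_n := ltn_ord i.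
have jn : (n - i.+1 < n)%N by lia.
have := unit_vec_krylov_A jn; rewrite (_ : n - _ = i)%N; last lia.
by apply: krylovS; lia.
Qed.

Lemma mem_orth_image (U : 'M[R]_n) (H : {vspace 'cV[R]_n}) x :
  orthogonal_mx U -> U *m x \in H -> x \in orth_image U H.
Proof.
move=> oU Ux; rewrite (_ : x = linfun (mulmx U^T : 'cV[R]_n -> 'cV[R]_n) (U *m x)).
  exact: memv_img.
by rewrite lfunE /= mulmxA oU mul1mx.
Qed.

End KrylovSubspaces.

(** * The resisting oracle: adaptive choice of the rotations *)

Section ResistingOracle.
Variable R : realType.

Lemma historyE n m (th : params R) (Alg : prox_algorithm R n m) P z0 k :
  history th Alg P z0 k = [seq iterate th Alg P z0 j | j <- iota 0 k.+1].
Proof.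
elim: k => [|k IH] //.
have -> : iota 0 k.+2 = rcons (iota 0 k.+1) k.+1.
  by rewrite -cats1 -(iotaD 0 k.+1 1) addn1.
by rewrite map_rcons -IH /= /iterate /= last_rcons.
Qed.

Lemma iterateS n m (th : params R) (Alg : prox_algorithm R n m) P z0 k :
  iterate th Alg P z0 k.+1
  = (step th Alg P k.+1 (history th Alg P z0 k)).1.
Proof. exact: last_rcons. Qed.

Lemma outputS n m (th : params R) (Alg : prox_algorithm R n m) P z0 k :
  output th Alg P z0 k.+1 = (step th Alg P k.+1 (history th Alg P z0 k)).2.
Proof. by []. Qed.

(** Equal [f] and [g] give equal proxes, and all matrix products revealed up to time [k] agree, so a
    deterministic algorithm cannot tell the problems apart. The agreement extends to [step] at
    [k.+1], whose iterate has not yet been multiplied by the matrix. *)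
Lemma history_indistinguishable n m (th : params R) (Alg : prox_algorithm R n m)
    P P' z0 k :
  prob_f P' = prob_f P -> prob_g P' = prob_g P ->
  (forall j, (j <= k)%N -> let z := iterate th Alg P z0 j in
    prob_C P' *m z.2 = prob_C P *m z.2 /\
    (prob_C P')^T *m z.1 = (prob_C P)^T *m z.1) ->
  forall j, (j <= k)%N ->
    history th Alg P' z0 j = history th Alg P z0 j /\
    step th Alg P' j.+1 (history th Alg P' z0 j)
      = step th Alg P j.+1 (history th Alg P z0 j).
Proof.
move=> ef eg eC.
(* The two problems are first compared on the history of [P] alone; the induction below then
   identifies the history of [P'] with it. *)
have stepE j : (j <= k)%N ->
    step th Alg P' j.+1 (history th Alg P z0 j)
      = step th Alg P j.+1 (history th Alg P z0 j).
  move=> jk; set h := history _ _ _ _ _.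
  have hz z : z \in h -> prob_C P' *m z.2 = prob_C P *m z.2 /\
      (prob_C P')^T *m z.1 = (prob_C P)^T *m z.1.
    rewrite /h historyE => /mapP[i]; rewrite mem_iota => ik ->.
    by apply: eC; lia.
  have hx : hist_x P' h = hist_x P h.
    by apply/eq_in_map => z /hz[-> _].
  have hy : hist_y P' h = hist_y P h.
    by apply/eq_in_map => z /hz[_ ->].
  by rewrite /step hx hy ef eg.
elim=> [|j IH] jk; first by split; [by []|exact: stepE].
have [hj sj] := IH (ltnW jk).
have hj1 : history th Alg P' z0 j.+1 = history th Alg P z0 j.+1.
  rewrite -[LHS]/(rcons (history th Alg P' z0 j)
    (step th Alg P' j.+1 (history th Alg P' z0 j)).1).
  by rewrite sj hj.
by split; [exact: hj1|rewrite hj1; exact: stepE].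
Qed.

Section Rotation.
Variables (n : nat) (th : params R) (Alg : prox_algorithm R n n).
Let run U V := iterate th Alg (rotated_problem th U V) (0, 0).
Let out U V := output th Alg (rotated_problem th U V) (0, 0).

Lemma supp_in_hard_b : supp_in (first_coords n 1) (hard_b th n).
Proof.
apply: supp_inZ => i; rewrite inE -ltnNge => i1; rewrite mxE gtn_eqF //.
Qed.

(** [W] fixes [V y], [A] moves it into the last [2 * k] coordinates, and those are fixed by [Q]. In
    the other direction [A] adds one coordinate, hence [(2 * k).+1] for [W]; this bound includes the
    first coordinate even at [k = 0], so the linear term of [g] is unchanged. *)
Lemma rotated_prefix k (U V Q W : 'M[R]_n) :
  orthogonal_mx Q -> orthogonal_mx W ->
  (forall x, supp_in (last_coords n (2 * k)) x -> Q *m x = x) ->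
  (forall x, supp_in (first_coords n (2 * k).+1) x -> W *m x = x) ->
  (forall j, (j <= k)%N ->
     supp_in (last_coords n (2 * k)) (U *m (run U V j).1) /\
     supp_in (first_coords n (2 * k)) (V *m (run U V j).2)) ->
  forall j, (j <= k)%N -> run (Q *m U) (W *m V) j = run U V j /\
    step th Alg (rotated_problem th (Q *m U) (W *m V)) j.+1
      (history th Alg (rotated_problem th (Q *m U) (W *m V)) (0, 0) j)
    = step th Alg (rotated_problem th U V) j.+1
      (history th Alg (rotated_problem th U V) (0, 0) j).
Proof.
move=> oQ oW fQ fW inv j jk.
have [|||hj sj] := history_indistinguishable (Alg := Alg) (th := th) (k := k)
  (P := rotated_problem th U V) (P' := rotated_problem th (Q *m U) (W *m V))
  (z0 := (0, 0)) _ _ _ jk.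
- by [].
- apply/funext => y /=; congr (_ + _)%:E; rewrite !dotp_mulmx trmx_mul -mulmxA.
  rewrite (orthogonal_fixT oW) //; apply: fW.
  by apply: supp_in_sub supp_in_hard_b; apply: first_coordsS.
- move=> i /inv[Ux Vy] /=; split.
    rewrite -!scalemxAl; congr (_ *: _).
    rewrite trmx_mul -!mulmxA; congr (_ *m _).
    rewrite fW; last by apply: supp_in_sub Vy; apply: first_coordsS.
    by rewrite (orthogonal_fixT oQ) //; apply: fQ; apply: hard_A_first.
  rewrite !linearZ /= -!scalemxAl; congr (_ *: _).
  rewrite !trmx_mul !trmxK trmx_hard_A -!mulmxA; congr (_ *m _).
  rewrite fQ //.
  by rewrite (orthogonal_fixT oW) //; apply: fW; apply: hard_A_last.
split; last exact: sj.
by rewrite /run /iterate hj.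
Qed.

(** Induction on the horizon. Iteration [k.+1] opens two coordinates per side, one for the iterate
    and one more for the output; the output bounds at [k] are exactly the coordinates that the next
    rotation fixes. *)
Lemma resisting_rotation k : (2 * k < n)%N ->
  exists U V : 'M[R]_n, [/\ orthogonal_mx U, orthogonal_mx V,
    forall j, (j <= k)%N ->
      supp_in (last_coords n (2 * k).-1) (U *m (run U V j).1) /\
      supp_in (first_coords n (2 * k)) (V *m (run U V j).2) &
    forall j, (0 < j <= k)%N ->
      supp_in (last_coords n (2 * k)) (U *m (out U V j).1) /\
      supp_in (first_coords n (2 * k).+1) (V *m (out U V j).2)].
Proof.
elim: k => [|k IH] kn.
  (* At [k = 0] the truncated [(2 * 0).-1] is 0, which suits the zero start, and there is no output
     yet. *)
  exists 1%:M, 1%:M; split=> [||[|//] _|[|//]//]; try exact: orthogonal_mx1.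
  by rewrite /run /iterate /= !mulmx0; split; apply: supp_in0.
have [|U [V [oU oV inv invo]]] := IH; first lia.
set P := rotated_problem th U V.
set s := step th Alg P k.+1 (history th Alg P (0, 0) k).
(* The fresh coordinates: the next two from the end on the x side, and the two following the first
   [(2 * k).+1] on the y side. *)
have x0P : (n - (2 * k).+1 < n)%N by lia.
have x1P : (n - (2 * k).+2 < n)%N by lia.
have y0P : ((2 * k).+1 < n)%N by lia.
have y1P : ((2 * k).+2 < n)%N by lia.
have [||Q [oQ fQ Qp Qw]] := @exists_reflection2 R n (last_coords n (2 * k))
  (Ordinal x0P) (Ordinal x1P) (U *m s.1.1) (U *m s.2.1).
- by rewrite inE /=; lia.
- by rewrite !inE /= -(inj_eq val_inj) /=; lia.
have [||W [oW fW Wp Ww]] := @exists_reflection2 R n (first_coords n (2 * k).+1)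
  (Ordinal y0P) (Ordinal y1P) (V *m s.1.2) (V *m s.2.2).
- by rewrite inE /=; lia.
- by rewrite !inE /= -(inj_eq val_inj) /=; lia.
have inv' j : (j <= k)%N -> supp_in (last_coords n (2 * k)) (U *m (run U V j).1) /\
    supp_in (first_coords n (2 * k)) (V *m (run U V j).2).
  by move=> /inv[Ux Vy]; split=> //; apply: supp_in_sub Ux; apply: last_coordsS; lia.
have pre := rotated_prefix oQ oW fQ fW inv'.
have lastU m (x : 'cV[R]_n) : (2 * k < m)%N -> supp_in (Ordinal x0P |: last_coords n (2 * k)) x ->
    supp_in (last_coords n m) x.
  by move=> km; apply: supp_in_sub; apply/fintype.subsetP => i; rewrite !inE;
    move=> /orP[/eqP -> /=|]; lia.
have lastUU (x : 'cV[R]_n) : supp_in (Ordinal x1P |: (Ordinal x0P |: last_coords n (2 * k))) x ->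
    supp_in (last_coords n (2 * k.+1)) x.
  by apply: supp_in_sub; apply/fintype.subsetP => i; rewrite !inE;
    move=> /or3P[/eqP -> /=|/eqP -> /=|]; lia.
have firstU m (x : 'cV[R]_n) : ((2 * k).+1 < m)%N ->
    supp_in (Ordinal y0P |: first_coords n (2 * k).+1) x ->
    supp_in (first_coords n m) x.
  by move=> km; apply: supp_in_sub; apply/fintype.subsetP => i; rewrite !inE;
    move=> /orP[/eqP -> /=|]; lia.
have firstUU (x : 'cV[R]_n) :
    supp_in (Ordinal y1P |: (Ordinal y0P |: first_coords n (2 * k).+1)) x ->
    supp_in (first_coords n (2 * k.+1).+1) x.
  by apply: supp_in_sub; apply/fintype.subsetP => i; rewrite !inE;
    move=> /or3P[/eqP -> /=|/eqP -> /=|]; lia.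
(* Step [k.+1] still sees the old history, so its results are those recorded in [s]. *)
have [_ sk] := pre k (leqnn k).
exists (Q *m U), (W *m V); split; [exact: orthogonal_mul|exact: orthogonal_mul| |].
- move=> j; rewrite leq_eqVlt => /predU1P[->|jk].
    rewrite /run iterateS sk -/s -!mulmxA.
    by split; [apply: lastU Qp; lia|apply: firstU Wp; lia].
  have [-> _] := pre j jk; have [Ux Vy] := inv' j jk.
  have Vy1 := supp_in_sub (first_coordsS n (leqnSn (2 * k))) Vy.
  rewrite -!mulmxA (fQ _ Ux) (fW _ Vy1).
  split; first by apply: supp_in_sub Ux; apply: last_coordsS; lia.
  by apply: supp_in_sub Vy; apply: first_coordsS; lia.
- move=> [//|j] /andP[_]; rewrite ltnS leq_eqVlt => /predU1P[->|jk].
    rewrite /out outputS sk -/s -!mulmxA.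
    by split; [exact: lastUU Qw|exact: firstUU Ww].
  have [_ sj] := pre j (ltnW jk).
  (* Earlier outputs lie in the coordinates that [Q] and [W] fix. *)
  have [Ux Vy] := invo j.+1 jk.
  rewrite /out outputS sj -!mulmxA -outputS.
  rewrite (fQ _ Ux) (fW _ Vy).
  split; first by apply: supp_in_sub Ux; apply: last_coordsS; lia.
  by apply: supp_in_sub Vy; apply: first_coordsS; lia.
Qed.

End Rotation.
End ResistingOracle.

(** * Membership of the rotated instance in the problem class *)

Section HardInstanceInClass.
Variable R : realType.
Implicit Types n : nat.

Lemma continuous_coord n i : continuous (fun x : 'cV[R]_n => x i 0).
Proof. by move=> x; apply: coord_continuous. Qed.

Lemma continuous_sqnorm n : continuous (@sqnorm R n).
Proof.
rewrite (_ : @sqnorm R n = fun x : 'cV[R]_n => \sum_i x i 0 * x i 0).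
  apply: (@continuous_big R _ +%R 0 xpredT _ _ _ (fun i (x : 'cV[R]_n) => x i 0 * x i 0)).
    by move=> z; apply: add_continuous.
  move=> i _ x; exact: (cvgM (@continuous_coord n i x) (@continuous_coord n i x)).
by apply/funext => x; rewrite /sqnorm dotpE.
Qed.

Lemma continuous_dotp n (c : 'cV[R]_n) : continuous (dotp c).
Proof.
rewrite (_ : dotp c = fun x : 'cV[R]_n => \sum_i c i 0 * x i 0).
  apply: (@continuous_big R _ +%R 0 xpredT _ _ _ (fun i (x : 'cV[R]_n) => c i 0 * x i 0)).
    by move=> z; apply: add_continuous.
  move=> i _ x; exact: (cvgM (cvg_cst (c i 0)) (@continuous_coord n i x)).
by apply/funext => x; rewrite dotpE.
Qed.

Lemma lower_semicontinuous_EFin (X : topologicalType) (h : X -> R) :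
  continuous h -> lower_semicontinuous (fun x => (h x)%:E).
Proof.
move=> ch x a; rewrite lte_fin => ax.
exists [set y | a < h y]%classic; first exact: (cvgr_gt _ (ch x) _ ax).
by move=> y; rewrite lte_fin.
Qed.

Lemma sqnorm_convex_combination n (x y : 'cV[R]_n) t :
  sqnorm (t *: x + (1 - t) *: y) + t * (1 - t) * sqnorm (x - y)
  = t * sqnorm x + (1 - t) * sqnorm y.
Proof.
rewrite /sqnorm !(dotpBl, dotpBr, dotpDl, dotpDr, dotpZl, dotpZr) (dotpC y x).
by ring.
Qed.

Lemma quadratic_strongly_convex n mu (c : 'cV[R]_n) :
  strongly_convex mu (fun x => (mu / 2 * sqnorm x + dotp c x)%:E).
Proof.
move=> x y t _; rewrite -!EFinM -!EFinD lee_fin dotpDr !dotpZr.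
have := sqnorm_convex_combination x y t.
set s := sqnorm (_ *: _ + _) => h.
(* For an isotropic quadratic, strong convexity holds with equality. *)
rewrite le_eqVlt; apply/orP; left; apply/eqP.
transitivity (mu / 2 * (s + t * (1 - t) * sqnorm (x - y))
  + (t * dotp c x + (1 - t) * dotp c y)); first by ring.
by rewrite h; ring.
Qed.

Lemma quadratic_lower_semicontinuous n mu (c : 'cV[R]_n) :
  lower_semicontinuous (fun x => (mu / 2 * sqnorm x + dotp c x)%:E).
Proof.
apply: lower_semicontinuous_EFin => x.
exact: (cvgD (cvgM (cvg_cst (mu / 2)) (@continuous_sqnorm n x))
  (@continuous_dotp n c x)).
Qed.

Lemma spectral_norm_le m n (C : 'M[R]_(m, n)) L : 0 <= L ->
  (forall x, sqnorm (C *m x) <= L ^+ 2 * sqnorm x) -> spectral_norm C <= L.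
Proof.
move=> L0 CL; apply: ge_sup.
  by exists (l2norm (C *m 0)), 0; rewrite //= /l2norm sqnorm0 sqrtr0.
move=> _ [x /= x1 <-]; rewrite -(ger0_norm L0) -sqrtr_sqr.
rewrite ler_sqrt ?sqr_ge0 //; apply: le_trans (CL x) _.
rewrite -[leRHS]mulr1 ler_wpM2l ?sqr_ge0 //.
by rewrite -[sqnorm x]sqr_sqrtr ?sqnorm_ge0 // expr_le1 // sqrtr_ge0.
Qed.

Lemma rotated_in_class n (th : params R) (U V : 'M[R]_n) : 0 < Lxy th ->
  orthogonal_mx U -> orthogonal_mx V -> rotated_F_in_class th U V.
Proof.
move=> L0 oU oV; split.
  move=> x y; rewrite /objective /= -!EFinD; congr EFin.
  rewrite /rotated_F /hard_F !sqnorm_orthogonal // -scalemxAl dotpZr.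
  rewrite -!mulmxA dotp_mulmx trmxK; ring.
(* A zero linear term gives [f] the same shape as [g]. *)
have fE : prob_f (rotated_problem th U V)
    = fun x => (mux th / 2 * sqnorm x + dotp 0 x)%:E.
  by apply/funext => x /=; rewrite /dotp trmx0 mul0mx mxE addr0.
have gE : prob_g (rotated_problem th U V)
    = fun y => (muy th / 2 * sqnorm y + dotp (V^T *m hard_b th n) y)%:E.
  by apply/funext => y /=; rewrite dotp_mulmx.
rewrite /class_B fE gE; split.
- by split; split=> //; exists 0.
- by split; apply: quadratic_lower_semicontinuous.
- exact: quadratic_strongly_convex.
- exact: quadratic_strongly_convex.
- apply: spectral_norm_le => [|x]; first exact: ltW.
  rewrite /= -scalemxAl sqnormZ -!mulmxA.
  rewrite sqnorm_orthogonal; last exact: orthogonal_trmx.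
  rewrite -(sqnorm_orthogonal x oV).
  have := sqnorm_hard_A (V *m x); set a := sqnorm (hard_A _ _ *m _) => aV.
  have := ler_wpM2l (sqr_ge0 (Lxy th / 2)) aV.
  lra.
Qed.

End HardInstanceInClass.

(** * Closed form of the saddle point, and the duality gap *)

Section SaddlePoint.
Variables (R : realType) (th : params R).
Hypotheses (L_gt0 : 0 < Lxy th) (mux_gt0 : 0 < mux th) (muy_gt0 : 0 < muy th).
Local Notation L := (Lxy th).
Let kappa := mux th * muy th / L ^+ 2.
Let q := rate_q th.

Lemma kappa_gt0 : 0 < kappa.
Proof. by rewrite divr_gt0 ?mulr_gt0 ?exprn_gt0. Qed.

(** [q] is the smaller root of the characteristic polynomial of the recurrence given by the interior
    rows of [A^2 + 4 kappa]. *)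
Lemma rate_q_root : q ^+ 2 + 1 = q * (2 + 4 * kappa).
Proof.
rewrite /q /rate_q -/kappa.
have := sqr_sqrtr (addr_ge0 (sqr_ge0 kappa) (ltW kappa_gt0)).
set s := Num.sqrt _ => ss.
transitivity (1 + (1 + 2 * kappa) ^+ 2 - 4 * (1 + 2 * kappa) * s + 4 * s ^+ 2).
  by ring.
by rewrite ss; ring.
Qed.

(** Amounts to [kappa < s < kappa + 1/2] for the square root [s] of [kappa^2 + kappa]. *)
Lemma rate_q_in01 : 0 < q < 1.
Proof.
have k0 := kappa_gt0; rewrite /q /rate_q -/kappa.
have := sqr_sqrtr (addr_ge0 (sqr_ge0 kappa) (ltW k0)).
have := sqrtr_ge0 (kappa ^+ 2 + kappa).
set s := Num.sqrt _ => s0 ss.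
have ks : kappa < s.
  have : kappa ^+ 2 < s ^+ 2 by rewrite ss; lra.
  by rewrite ltr_sqr // nnegrE ltW.
have sk : s < kappa + 1 / 2.
  have : s ^+ 2 < (kappa + 1 / 2) ^+ 2 by rewrite ss; lra.
  by rewrite ltr_sqr // nnegrE; lra.
by apply/andP; split; lra.
Qed.

Let q_gt0 : 0 < q. Proof. by case/andP: rate_q_in01. Qed.
Let q_lt1 : q < 1. Proof. by case/andP: rate_q_in01. Qed.

Definition saddle_scale n : R := q / ((1 - q) * (1 + q ^+ (2 * n).+1)).

(* The decaying solution q^i of the recurrence, reflected at the index n so that
   the boundary value vanishes; the scale comes from the first equation. *)
Definition saddle_seq n i : R := saddle_scale n * (q ^+ i - q ^+ (2 * n - i)).

Definition saddle_y n : 'cV[R]_n := \col_i saddle_seq n i.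
Definition saddle_x n : 'cV[R]_n := - (L / (2 * mux th)) *: (hard_A R n *m saddle_y n).

Lemma saddle_scale_gt0 n : 0 < saddle_scale n.
Proof. by rewrite divr_gt0 // mulr_gt0 ?subr_gt0 // ltr_wpDr // exprn_ge0 // ltW. Qed.

(** The equation left after eliminating [x] from the stationarity conditions. Interior rows hold
    because [q^i] and [q^(2n-i)] both solve the recurrence; row 0 determines the scale. *)
Lemma saddle_equation n :
  hard_A R n *m (hard_A R n *m saddle_y n) + (4 * kappa) *: saddle_y n = e1 R n.
Proof.
have fn : saddle_seq n n = 0 by rewrite /saddle_seq mul2n -addnn addnK subrr mulr0.
rewrite /saddle_y (hard_A2_mul fn); apply/colP => i; rewrite !mxE.
have i_n := ltn_ord i; have qr := rate_q_root.
case: (nat_of_ord i) i_n => [|j] jn; rewrite /saddle_seq /=.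
  have -> : (2 * n - 0 = (2 * n - 1).+1)%N by lia.
  have e : saddle_scale n * (1 - q) * (1 + q ^+ 2 * q ^+ (2 * n - 1)) = q.
    rewrite -exprD (_ : 2 + (2 * n - 1) = (2 * n).+1)%N; last lia.
    rewrite -mulrA divfK // gt_eqF // mulr_gt0 ?subr_gt0 //.
    by rewrite ltr_wpDr // exprn_ge0 // ltW.
  rewrite expr0 expr1 exprS; move: e.
  set d := q ^+ (2 * n - 1); set c := saddle_scale n => e.
  (* Multiplying row 0 by [q] makes [q * (2 + 4 * kappa)] appear, which [rate_q_root] eliminates. *)
  apply: (mulfI (lt0r_neq0 q_gt0)); rewrite mulr1 -[RHS]e.
  transitivity (c * (q * (2 + 4 * kappa) * (1 - q * d) - q * (1 - q * d + q - d))).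
    by ring.
  by rewrite -qr; ring.
have -> : (2 * n - j.+1 = (2 * n - j.+2).+1)%N by lia.
have -> : (2 * n - j = (2 * n - j.+2).+2)%N by lia.
rewrite !exprS; set a := q ^+ j; set d := q ^+ _; set c := saddle_scale n.
transitivity (c * (q * (2 + 4 * kappa) * (a - d) - (q * (q * a) - d) - (a - q * (q * d)))).
  by ring.
by rewrite -qr; ring.
Qed.

Lemma saddle_x_critical n :
  (L / 2) *: (hard_A R n *m saddle_y n) = - (mux th *: saddle_x n).
Proof.
rewrite scalerA -scaleNr; congr (_ *: _).
by field; rewrite gt_eqF.
Qed.

(** Stationarity in [y]: expressing [e1] in [b] through [saddle_equation] cancels the [A^2] terms,
    and [4 * kappa * L^2 / (4 * mux)] equals [muy]. *)
Lemma saddle_y_critical n :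
  (L / 2) *: (hard_A R n *m saddle_x n) - hard_b th n = muy th *: saddle_y n.
Proof.
rewrite /saddle_x -scalemxAr scalerA /hard_b -saddle_equation scaleNr opprK.
rewrite mulrN scaleNr scalerDr addrA.
rewrite (_ : L / 2 * _ = L ^+ 2 / (4 * mux th)); last by field; rewrite gt_eqF.
rewrite addNr add0r scalerA; congr (_ *: _).
by rewrite /kappa; field; rewrite !gt_eqF.
Qed.

(** An exact second-order expansion: the function is quadratic in [x] with Hessian [mux] times the
    identity, and its gradient vanishes at [saddle_x]. *)
Lemma hard_F_saddle_x n (x : 'cV[R]_n) :
  hard_F th x (saddle_y n) = hard_F th (saddle_x n) (saddle_y n)
    + mux th / 2 * sqnorm (x - saddle_x n).
Proof.
have E z : L / 2 * dotp z (hard_A R n *m saddle_y n) = - (mux th * dotp z (saddle_x n)).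
  by rewrite -dotpZr saddle_x_critical -scaleNr dotpZr mulNr.
rewrite /hard_F !E /sqnorm !(dotpBl, dotpBr) (dotpC (saddle_x n) x).
by field.
Qed.

Lemma hard_F_saddle_y n (y : 'cV[R]_n) :
  hard_F th (saddle_x n) y = hard_F th (saddle_x n) (saddle_y n)
    - muy th / 2 * sqnorm (y - saddle_y n).
Proof.
have E z : L / 2 * dotp (saddle_x n) (hard_A R n *m z) - dotp (hard_b th n) z
    = muy th * dotp z (saddle_y n).
  rewrite dotp_mulmx trmx_hard_A -dotpZl -dotpBl saddle_y_critical dotpZl.
  by rewrite dotpC.
have Ey := E y; have Es := E (saddle_y n).
rewrite /hard_F /sqnorm !(dotpBl, dotpBr) (dotpC (saddle_y n) y).
lra.
Qed.

(** For a second saddle point [(x', y')], the value at [(x', saddle_y)] is at most the value at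
    [(saddle_x, y')]; the two expansions then force both squared distances to vanish. *)
Lemma unique_saddle n :
  unique (saddle_point (@hard_F R th n)) (saddle_x n, saddle_y n).
Proof.
split=> [x y /=|[x' y'] sp].
  rewrite (hard_F_saddle_x x) (hard_F_saddle_y y) lerDl gerDl oppr_le0.
  by rewrite !mulr_ge0 ?sqnorm_ge0 ?invr_ge0 // ltW.
have /andP[h1 h2] := sp (saddle_x n) (saddle_y n).
move: (le_trans h1 h2) => /=; rewrite (hard_F_saddle_x x') (hard_F_saddle_y y') => h.
have := sqnorm_ge0 (x' - saddle_x n); have := sqnorm_ge0 (y' - saddle_y n).
set s := sqnorm (y' - _) in h *; set t := sqnorm (x' - _) in h * => s0 t0.
have ms : 0 <= muy th / 2 * s by rewrite mulr_ge0 // divr_ge0 // ltW.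
have mt : 0 <= mux th / 2 * t by rewrite mulr_ge0 // divr_ge0 // ltW.
have /eqP : muy th / 2 * s = 0 by lra.
have /eqP : mux th / 2 * t = 0 by lra.
rewrite !mulf_eq0 !invr_eq0 !pnatr_eq0 (gt_eqF mux_gt0) (gt_eqF muy_gt0) /= => /eqP te /eqP se.
congr pair; apply/esym/eqP; rewrite -subr_eq0 -sqnorm_eq0.
  by rewrite -/t te.
by rewrite -/s se.
Qed.

(** The rotated saddle point is a test point in both the maximum and the minimum. *)
Lemma duality_gap_ge n (U V : 'M[R]_n) zt :
  orthogonal_mx U -> orthogonal_mx V ->
  ((muy th / 2 * sqnorm (V *m zt.2 - saddle_y n))%:E
    <= duality_gap (rotated_F th U V) zt)%E.
Proof.
move=> oU oV; rewrite /duality_gap.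
set Fs := hard_F th (saddle_x n) (saddle_y n).
have h1 : (Fs%:E <= ereal_sup
    [set (rotated_F th U V zt.1 y)%:E | y in [set: 'cV[R]_n]]%classic)%E.
  apply: (@le_trans _ _ (rotated_F th U V zt.1 (V^T *m saddle_y n))%:E).
    rewrite lee_fin /rotated_F mulmxA orthogonal_mxC // mul1mx hard_F_saddle_x.
    by rewrite lerDl mulr_ge0 ?sqnorm_ge0 // divr_ge0 // ltW.
  by apply: ereal_sup_ubound; exists (V^T *m saddle_y n).
have h2 : (ereal_inf [set (rotated_F th U V x zt.2)%:E | x in [set: 'cV[R]_n]]%classic
    <= (Fs - muy th / 2 * sqnorm (V *m zt.2 - saddle_y n))%:E)%E.
  rewrite -hard_F_saddle_y; apply: ereal_inf_lbound.
  exists (U^T *m saddle_x n) => //.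
  by rewrite /rotated_F mulmxA orthogonal_mxC // mul1mx.
apply: le_trans (leeB h1 h2).
by rewrite -EFinB lee_fin; lra.
Qed.

End SaddlePoint.

(** * Quantitative decay of the saddle point, and bounds on [q] *)

Section DecayBounds.
Variable R : realType.

Lemma geometric_sum_sqr (q : R) h :
  (1 - q ^+ 2) * (\sum_(i < h) (q ^+ i) ^+ 2) = 1 - (q ^+ h) ^+ 2.
Proof.
elim: h => [|h IH]; first by rewrite big_ord0 mulr0 expr1n subrr.
by rewrite big_ord_recr /= mulrDr IH [q ^+ h.+1]exprS; ring.
Qed.

(** [h] is the excess dimension that makes the reflected term [q^(2n-i)] at most half of [q^i]. *)
Lemma exists_expr_le_half (q : R) : 0 < q < 1 -> exists h, q ^+ h <= 1 / 2.
Proof.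
move=> /andP[q0 q1].
have cq : (q ^+ n @[n --> \oo] --> (0 : R))%classic.
  by apply: cvg_expr; rewrite ger0_norm // ltW.
have [h _ /(_ h) hP] := cvgr_lt _ cq (1 / 2) (divr_gt0 ltr01 (ltr0Sn R 1)).
by exists h; apply/ltW/hP => /=.
Qed.

Variable th : params R.
Hypotheses (L_gt0 : 0 < Lxy th) (mux_gt0 : 0 < mux th) (muy_gt0 : 0 < muy th).
Let kappa := mux th * muy th / Lxy th ^+ 2.
Local Notation q := (rate_q th).
Let q01 := rate_q_in01 L_gt0 mux_gt0 muy_gt0.
Let q_gt0 : 0 < q. Proof. by case/andP: q01. Qed.
Let q_lt1 : q < 1. Proof. by case/andP: q01. Qed.
Let q_ge0 := ltW q_gt0.
Let q_le1 := ltW q_lt1.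

(** Each entry is at most [c * q^i]; summing the squares gives a geometric series. *)
Lemma sqnorm_saddle_y_le n :
  (1 - q ^+ 2) * sqnorm (saddle_y th n) <= saddle_scale th n ^+ 2.
Proof.
set c := saddle_scale th n.
have c0 : 0 < c by apply: saddle_scale_gt0.
have le1 : sqnorm (saddle_y th n) <= c ^+ 2 * (\sum_(i < n) (q ^+ i) ^+ 2).
  rewrite sqnormE mulr_sumr; apply: ler_sum => i _.
  rewrite mxE /saddle_seq -/c exprMn ler_wpM2l ?sqr_ge0 //.
  have i_n := ltn_ord i.
  have d : q ^+ (2 * n - i) <= q ^+ i by apply: ler_wiXn2l => //; lia.
  rewrite ler_sqr ?nnegrE ?subr_ge0 ?exprn_ge0 //.
  by rewrite gerBl exprn_ge0.
have q2 : 0 <= 1 - q ^+ 2 by rewrite subr_ge0 expr_le1.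
apply: le_trans (ler_wpM2l q2 le1) _.
rewrite mulrCA geometric_sum_sqr -[leRHS]mulr1 ler_wpM2l ?sqr_ge0 //.
by rewrite gerBl sqr_ge0.
Qed.

(** Only the window of coordinates from [m] to [m + h - 1] is counted: there [y] is zero and the
    saddle entry is at least [c * q^i / 2]. The halving costs 1/4 and the finite geometric sum
    another 1/2, so 1/16 is within reach. *)
Lemma dist_saddle_y_ge n m h (y : 'cV[R]_n) :
  q ^+ h <= 1 / 2 -> (m + 2 * h <= n)%N -> supp_in (first_coords n m) y ->
  q ^+ (2 * m) / 16 * sqnorm (saddle_y th n) <= sqnorm (y - saddle_y th n).
Proof.
move=> qh mn Sy; set c := saddle_scale th n.
have c0 : 0 < c by apply: saddle_scale_gt0.
have q2 : 0 < 1 - q ^+ 2 by rewrite subr_gt0 expr_lt1.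
pose G i := extend (y - saddle_y th n) i ^+ 2.
have sG : sqnorm (y - saddle_y th n) = \sum_(0 <= i < n) G i.
  rewrite big_mkord sqnormE; apply: eq_bigr => i _.
  by rewrite /G -{1}[y - _]extendK mxE.
have Ge i : (m <= i < m + h)%N -> (c / 2 * q ^+ i) ^+ 2 <= G i.
  move=> /andP[mi im]; have i_n : (i < n)%N by clear -im mn; lia.
  rewrite /G /extend insubT !mxE Sy ?inE -?leqNgt //= sub0r sqrrN /saddle_seq -/c.
  have -> : q ^+ (2 * n - i) = q ^+ i * q ^+ (2 * (n - i)).
    by rewrite -exprD; congr (_ ^+ _); clear -i_n; lia.
  have d : q ^+ (2 * (n - i)) <= 1 / 2.
    by apply: le_trans qh; apply: ler_wiXn2l => //; clear -mn im; lia.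
  have qi : 0 < q ^+ i by apply: exprn_gt0.
  have e : c / 2 * q ^+ i <= c * (q ^+ i - q ^+ i * q ^+ (2 * (n - i))).
    rewrite -mulrA ler_wpM2l ?(ltW c0) //.
    have := ler_wpM2l (ltW qi) d; lra.
  have e0 : 0 <= c / 2 * q ^+ i by have := mulr_gt0 c0 qi; lra.
  by rewrite ler_sqr ?nnegrE // (le_trans e0).
have lower : \sum_(m <= i < m + h) (c / 2 * q ^+ i) ^+ 2 <= sqnorm (y - saddle_y th n).
  have mhn : (m + h <= n)%N by clear -mn; lia.
  rewrite sG (big_cat_nat (leq0n (m + h)) mhn) /=.
  rewrite (big_cat_nat (leq0n m) (leq_addr h m)) /=.
  have G0 a b : 0 <= \sum_(a <= i < b) G i.
    by apply: sumr_ge0 => i _; apply: sqr_ge0.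
  have : \sum_(m <= i < m + h) (c / 2 * q ^+ i) ^+ 2 <= \sum_(m <= i < m + h) G i.
    by apply: ler_sum_nat.
  by have := G0 0%N m; have := G0 (m + h)%N n; lra.
have sumE : \sum_(m <= i < m + h) (c / 2 * q ^+ i) ^+ 2
    = c ^+ 2 / 4 * q ^+ (2 * m) * \sum_(i < h) (q ^+ i) ^+ 2.
  rewrite -{1}[m]add0n big_addn addKn big_mkord mulr_sumr; apply: eq_bigr => i _.
  by rewrite exprMn exprD [(q ^+ _ * _) ^+ 2]exprMn mulnC exprM; field.
(* The factor [1 - q^2] clears the denominators of both geometric series. *)
rewrite -(ler_pM2l q2); apply: (@le_trans _ _ (q ^+ (2 * m) / 16 * c ^+ 2)).
  rewrite mulrCA ler_wpM2l ?sqnorm_saddle_y_le //.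
  by rewrite divr_ge0 // exprn_ge0.
apply: le_trans (ler_wpM2l (ltW q2) lower).
rewrite sumE [leRHS]mulrCA geometric_sum_sqr.
have h2 : (q ^+ h) ^+ 2 <= 1 / 2.
  have q0h : 0 <= q ^+ h by apply: exprn_ge0.
  by rewrite expr2; apply: le_trans (ler_wpM2l q0h qh) _; lra.
have Cm : 0 <= c ^+ 2 * q ^+ (2 * m) by rewrite mulr_ge0 ?sqr_ge0 ?exprn_ge0.
have := ler_wpM2l Cm h2; lra.
Qed.

(** The first coordinate suffices: it is at least [c * (1 - q)], and [c * (1 - q) * (1 + Q) = q]
    with [Q <= 1]. *)
Lemma sqnorm_saddle_y_ge n : (0 < n)%N -> q ^+ 2 / 4 <= sqnorm (saddle_y th n).
Proof.
move=> n0; set c := saddle_scale th n.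
have c0 : 0 < c by apply: saddle_scale_gt0.
have q1 : 0 < 1 - q by rewrite subr_gt0.
set Q := q ^+ (2 * n).+1.
have Q0 : 0 <= Q by apply: exprn_ge0.
have Q1 : Q <= 1 by apply: exprn_ile1.
have ce : c * ((1 - q) * (1 + Q)) = q.
  by rewrite divfK // mulf_neq0 // gt_eqF // ltr_wpDr.
have cq : q / 2 <= c * (1 - q).
  have : c * (1 - q) * Q <= c * (1 - q) * 1.
    by rewrite ler_wpM2l // mulr_ge0 // ltW.
  by move: ce; rewrite mulrA mulrDr; lra.
have y0 : c * (1 - q) <= saddle_seq th n 0.
  rewrite /saddle_seq -/c ler_wpM2l ?(ltW c0) // subn0 expr0 lerB //.
  by rewrite -[leRHS]expr1; apply: ler_wiXn2l => //; clear -n0; lia.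
rewrite sqnormE (bigD1 (Ordinal n0)) //= mxE /=.
apply: (@le_trans _ _ (saddle_seq th n 0 ^+ 2)).
  rewrite (_ : q ^+ 2 / 4 = (q / 2) ^+ 2); last by field.
  have q20 : 0 <= q / 2 by rewrite divr_ge0.
  have le0 := le_trans cq y0.
  by rewrite ler_sqr ?nnegrE // (le_trans q20).
by rewrite lerDl sumr_ge0 // => i _; apply: sqr_ge0.
Qed.

(** The inverse of [q] is the other root [1 + 2 * kappa + 2 * s]. With [s <= r + kappa] it is at
    most [(1 + 2 * r)^2], hence at most [expR (4 * r)]. *)
Lemma rate_q_ge_expR : expR (- (4 * Num.sqrt kappa)) <= q.
Proof.
have k0 : 0 < kappa by apply: kappa_gt0.
have rr := sqr_sqrtr (ltW k0); set r := Num.sqrt kappa in rr *.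
have r0 : 0 <= r by apply: sqrtr_ge0.
have := sqr_sqrtr (addr_ge0 (sqr_ge0 kappa) (ltW k0)).
have := sqrtr_ge0 (kappa ^+ 2 + kappa).
set s := Num.sqrt _ => s0 ss.
have sr : s <= r + kappa.
  have : s ^+ 2 <= (r + kappa) ^+ 2.
    rewrite ss sqrrD rr; have : 0 <= r * kappa by rewrite mulr_ge0 // ltW.
    by rewrite -mulr_natl; lra.
  by rewrite ler_sqr ?nnegrE // addr_ge0 // ltW.
have qs : q * (1 + 2 * kappa + 2 * s) = 1.
  rewrite /rate_q -/kappa -/s.
  transitivity ((1 + 2 * kappa) ^+ 2 - 4 * s ^+ 2); first by ring.
  by rewrite ss; ring.
have e1 : 1 + 2 * kappa + 2 * s <= expR (4 * r).
  rewrite (_ : 4 * r = 2 * r + 2 * r); last by ring.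
  rewrite expRD; have er := expR_ge1Dx (2 * r).
  have r2 : 0 <= 1 + 2 * r by lra.
  apply: le_trans (ler_pM r2 r2 er er).
  by rewrite mulrDr !mulrDl !mulr1 !mul1r -rr; rewrite -rr in sr; lra.
have p : 0 < 1 + 2 * kappa + 2 * s by lra.
have qV : q^-1 = 1 + 2 * kappa + 2 * s.
  by apply: (mulfI (lt0r_neq0 q_gt0)); rewrite qs divff // gt_eqF.
by rewrite expRN -[leRHS]invrK lef_pV2 ?posrE ?invr_gt0 ?expR_gt0 // qV.
Qed.

End DecayBounds.

(** * Distance bound and iteration complexity *)

Section LowerBounds.
Variables (R : realType) (L mx my : R).
Hypotheses (L_gt0 : 0 < L) (mx_gt0 : 0 < mx) (my_gt0 : 0 < my).
Let th := Params L mx my.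
Local Notation q := (rate_q th).

Lemma iterates_and_distance_bound k : (0 < k)%N ->
  exists N : nat, forall n : nat, (N <= n)%N ->
  exists zs : 'cV[R]_n * 'cV[R]_n,
    unique (saddle_point (@hard_F R th n)) zs /\
    forall Alg : prox_algorithm R n n,
    exists U V : 'M[R]_n,
      let P := rotated_problem th U V in
      let z := iterate th Alg P (0, 0) in
      let zt := output th Alg P (0, 0) in
      [/\ orthogonal_mx U /\ orthogonal_mx V,
          rotated_F_in_class th U V,
          forall j : nat, (j <= k)%N ->
            (z j).1 \in orth_image U (hard_Hx th n (4 * k - 1)) /\
            (z j).2 \in orth_image V (hard_Hy th n (4 * k - 1)),
          (zt k).1 \in orth_image U (hard_Hx th n (4 * k + 1)) /\
          (zt k).2 \in orth_image V (hard_Hy th n (4 * k + 1))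
        & q ^+ (4 * k + 2) / 16 * sqnorm (zs.2 - (z 0%N).2)
            <= sqnorm ((zt k).2 - V^T *m zs.2)].
Proof.
move=> k_gt0; have q01 := @rate_q_in01 R th L_gt0 mx_gt0 my_gt0.
have [h qh] := exists_expr_le_half q01.
exists ((2 * k).+1 + 2 * h)%N => n Nn.
exists (saddle_x th n, saddle_y th n); split; first exact: unique_saddle.
move=> Alg; have kn : (2 * k < n)%N by clear -Nn; lia.
have [U [V [oU oV inv invo]]] := resisting_rotation th Alg kn.
have [Ux Vy] := invo k ltac:(by rewrite k_gt0 leqnn).
have b0 : - (Lxy th ^+ 2 / (4 * mux th)) != 0.
  by rewrite oppr_eq0 gt_eqF // divr_gt0 ?exprn_gt0 ?mulr_gt0.
exists U, V; split; first by split.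
- exact: rotated_in_class.
(* The floor and ceiling of [(4k-1)/2] are [2k-1] and [2k], those of [(4k+1)/2] are [2k] and [2k+1]:
   exactly the supports found. *)
- move=> j /inv[Ujx Vjy]; split; apply: mem_orth_image => //.
    by apply: (mem_hard_Hx b0 Ujx); clear; lia.
  by apply: (mem_hard_Hy b0 Vjy); clear; lia.
- split; apply: mem_orth_image => //.
    by apply: (mem_hard_Hx b0 Ux); clear; lia.
  by apply: (mem_hard_Hy b0 Vy); clear; lia.
- have := @dist_saddle_y_ge R th L_gt0 mx_gt0 my_gt0 n (2 * k).+1 h _ qh Nn Vy.
  set w := output _ _ _ _ _.
  rewrite -[sqnorm (w.2 - _)](sqnorm_orthogonal _ oV) mulmxBr mulmxA.
  rewrite (orthogonal_mxC oV) mul1mx [iterate _ _ _ _ 0%N]/= subr0.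
  by rewrite (_ : 4 * k + 2 = 2 * (2 * k).+1)%N //; clear; lia.
Qed.

(** The rotations are fixed for the horizon [K], the integer part of the claimed bound [T], so one
    instance serves every [k]. Any [k < T] satisfies [k <= K], and its output still misses enough of
    the saddle point to have gap above [M * eps]. *)
Lemma iteration_complexity_bound M : 0 < M ->
  exists2 eps0 : R, 0 < eps0 &
  forall eps : R, 0 < eps < eps0 ->
  exists N : nat, forall n : nat, (N <= n)%N ->
  forall Alg : prox_algorithm R n n,
  exists U V : 'M[R]_n,
    let zt := output th Alg (rotated_problem th U V) (0, 0) in
    [/\ orthogonal_mx U /\ orthogonal_mx V,
        rotated_F_in_class th U V
      & forall k : nat, (0 < k)%N ->
        (duality_gap (rotated_F th U V) (zt k) <= (M * eps)%:E)%E ->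
        1 / 32 * (Num.sqrt (L ^+ 2 / (mx * my)) * ln (1 / eps)) <= k%:R].
Proof.
move=> M0; have q01 := @rate_q_in01 R th L_gt0 mx_gt0 my_gt0.
have /andP[q0 q1] := q01.
(* The product of [my / 2], [q^2 / 16] from the distance bound, and [q^2 / 4] from the norm of the
   saddle point. *)
pose D := my * q ^+ 4 / 128.
have D0 : 0 < D by rewrite divr_gt0 // mulr_gt0 // exprn_gt0.
(* The bound 1 makes the logarithm positive; the other makes [M * eps] smaller than [D] times the
   square root of [eps]. *)
exists (Num.min 1 ((D / M) ^+ 2)).
  by rewrite lt_min ltr01 exprn_gt0 // divr_gt0.
move=> eps /andP[eps_gt0]; rewrite lt_min => /andP[eps1 epsD].
pose T := 1 / 32 * (Num.sqrt (L ^+ 2 / (mx * my)) * ln (1 / eps)).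
have lneps : ln (1 / eps) = - ln eps by rewrite div1r lnV.
have T0 : 0 <= T.
  rewrite mulr_ge0 ?divr_ge0 // mulr_ge0 ?sqrtr_ge0 // lneps oppr_ge0.
  by apply: ln_le0; apply: ltW.
pose K := Num.truncn T.
have [h qh] := exists_expr_le_half q01.
exists ((2 * K).+1 + 2 * h)%N => n Nn Alg.
have kn : (2 * K < n)%N by clear -Nn; lia.
have [U [V [oU oV _ invo]]] := resisting_rotation th Alg kn.
exists U, V; split; [by split|exact: rotated_in_class|].
move=> k k_gt0; set w := output _ _ _ _ _ => gap.
rewrite -/T leNgt; apply/negP => kT.
have kK : (k <= K)%N by rewrite (truncn_ge_nat _ T0) (ltW kT).
have [_ Vy] := invo k ltac:(by rewrite k_gt0 kK).
have dist := @dist_saddle_y_ge R th L_gt0 mx_gt0 my_gt0 n (2 * K).+1 h _ qh Nn Vy.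
have ys := @sqnorm_saddle_y_ge R th L_gt0 mx_gt0 my_gt0 n ltac:(clear -kn; lia).
have gap_ge := @duality_gap_ge R th L_gt0 mx_gt0 my_gt0 n U V w oU oV.
have := le_trans gap_ge gap; rewrite lee_fin /=; apply/negP; rewrite -ltNge.
pose r := Num.sqrt (mx * my / L ^+ 2).
have r0 : 0 < r by rewrite sqrtr_gt0 divr_gt0 ?mulr_gt0 ?exprn_gt0.
have TE : r * T = - ln eps / 32.
  rewrite /T lneps (_ : L ^+ 2 / (mx * my) = (mx * my / L ^+ 2)^-1); last by rewrite invf_div.
  rewrite sqrtrV -/r; last by rewrite ltW // divr_gt0 ?mulr_gt0 ?exprn_gt0.
  by field; rewrite gt_eqF.
pose g := expR (ln eps / 2).
have g0 : 0 < g by apply: expR_gt0.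
have gg : g ^+ 2 = eps.
  by rewrite expr2 -expRD -splitr lnK ?posrE.
(* Source of 1/32: [q^(4K)] is at least [expR (- (16 * r * T))], and [r * T = - ln eps / 32] turns
   this into [g], the square root of [eps]. *)
have qK : g <= q ^+ (4 * K).
  have := @rate_q_ge_expR R th L_gt0 mx_gt0 my_gt0; rewrite -/r => qr.
  apply: (@le_trans _ _ (expR (- (4 * r)) ^+ (4 * K))); last first.
    by apply: lerXn2r qr; rewrite nnegrE ?expR_ge0 // ltW.
  rewrite -expRM_natr ler_expR natrM.
  have /andP[KT _] := truncn_itv T0.
  have := ler_wpM2l (ltW r0) KT; rewrite TE -/K.
  by move: (K%:R) => y; clear; lra.
have gD : M * eps < D * g.
  have : g < D / M.
    rewrite -ltr_sqr ?nnegrE ?gg //; [exact: ltW|].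
    by rewrite ltW // divr_gt0.
  rewrite ltr_pdivlMr // => gM.
  by rewrite -gg expr2 mulrA ltr_pM2r // mulrC.
apply: (lt_le_trans gD).
have qm : q ^+ (2 * (2 * K).+1) = q ^+ 2 * q ^+ (4 * K).
  by rewrite -exprD; congr (_ ^+ _); clear; lia.
have my2 : 0 <= my / 2 by rewrite divr_ge0 // ltW.
apply: le_trans (ler_wpM2l my2 dist).
have qm0 : 0 <= q ^+ (2 * (2 * K).+1) / 16 by rewrite divr_ge0 // exprn_ge0 // ltW.
apply: le_trans (ler_wpM2l my2 (ler_wpM2l qm0 ys)).
apply: le_trans (ler_wpM2l (ltW D0) qK) _.
rewrite qm /D le_eqVlt; apply/orP; left; apply/eqP.
by move: (q ^+ (4 * K)) => z; field.
Qed.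

End LowerBounds.

Theorem theorem3p7 (R : realType) :
  (forall (Lxy mux muy : R), 0 < Lxy -> 0 < mux -> 0 < muy ->
   let th := Params Lxy mux muy in
   forall k : nat, (0 < k)%N ->
   exists N : nat, forall n : nat, (N <= n)%N ->
   exists zs : 'cV[R]_n * 'cV[R]_n,
     unique (saddle_point (@hard_F R th n)) zs /\
     forall Alg : prox_algorithm R n n,
     exists U V : 'M[R]_n,
       let P := rotated_problem th U V in
       let z := iterate th Alg P (0, 0) in
       let zt := output th Alg P (0, 0) in
       [/\ orthogonal_mx U /\ orthogonal_mx V,
           rotated_F_in_class th U V,
           forall j : nat, (j <= k)%N ->
             (z j).1 \in orth_image U (hard_Hx th n (4 * k - 1)) /\
             (z j).2 \in orth_image V (hard_Hy th n (4 * k - 1)),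
           (zt k).1 \in orth_image U (hard_Hx th n (4 * k + 1)) /\
           (zt k).2 \in orth_image V (hard_Hy th n (4 * k + 1))
         & rate_q th ^+ (4 * k + 2) / 16 * sqnorm (zs.2 - (z 0%N).2)
             <= sqnorm ((zt k).2 - V^T *m zs.2)]) /\
  (exists2 c : R, 0 < c &
   forall (Lxy mux muy : R), 0 < Lxy -> 0 < mux -> 0 < muy ->
   let th := Params Lxy mux muy in
   forall M : R, 0 < M ->
   exists2 eps0 : R, 0 < eps0 &
   forall eps : R, 0 < eps < eps0 ->
   exists N : nat, forall n : nat, (N <= n)%N ->
   forall Alg : prox_algorithm R n n,
   exists U V : 'M[R]_n,
     let zt := output th Alg (rotated_problem th U V) (0, 0) in
     [/\ orthogonal_mx U /\ orthogonal_mx V,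
         rotated_F_in_class th U V
       & forall k : nat, (0 < k)%N ->
         (duality_gap (rotated_F th U V) (zt k) <= (M * eps)%:E)%E ->
         c * (Num.sqrt (Lxy ^+ 2 / (mux * muy)) * ln (1 / eps)) <= k%:R]).
Proof.
split=> [L mx my L0 mx0 my0 th k k0|]; first exact: iterates_and_distance_bound.
exists (1 / 32) => [|L mx my L0 mx0 my0 th M M0]; first by rewrite divr_gt0.
exact: iteration_complexity_bound.
Qed.
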